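(* Let $(\mathbb{R}^n,g)$ be a pseudo-Euclidean space, $n\geq 3$, with coordinates $x=(x_1,\dots,x_n)$ and $g_{ij}=\delta_{ij}\varepsilon_i$, $\varepsilon_i\in\{1,-1\}$. Consider non-constant smooth functions $\varphi(\xi)$ and $f(\xi)$, with $f$ positive, where $\xi=\sum_{i=1}^n\alpha_ix_i$, $\alpha_i\in\mathbb{R}$, $\sum_{i=1}^n\varepsilon_i\alpha_i^2=\varepsilon_{i_0}\in\{1,-1\}$, and the warped product $M=(\mathbb{R}^n,\overline g)\times_fF^m$, with $\overline g=\frac{1}{\varphi^2}g$ and $F^m$ a Ricci-flat semi-Riemannian manifold of dimension $m\geq 2$. Then $M$ is a Ricci-flat manifold if, and only if, $(\varphi,f)$ is one of the pairs $(\varphi_-,f_-)$, $(\varphi_+,f_+)$ given by $$\varphi_{\mp}(\xi)=k\left[\mp\beta(k_1\xi+k_2)\right]^{\mp\frac{\alpha}{\beta}},\qquad f_{\mp}(\xi)=\left[\mp\beta(k_1\xi+k_2)\right]^{\mp\frac{1}{\beta}},$$ where $k,k_1,k_2,\alpha,\beta$ are constants with $k,k_1>0$, $$\beta=\frac{\sqrt{m(n-1)(m+n-2)}}{n-1},\qquad \alpha=\frac{m\pm\beta}{n-2},$$ the signs corresponding as follows: $\alpha=\frac{m+\beta}{n-2}$ for $(\varphi_-,f_-)$ and $\alpha=\frac{m-\beta}{n-2}$ for $(\varphi_+,f_+)$. The solutions $\varphi_-$ and $f_-$ are defined on the half space determined by $\sum_{i=1}^n\alpha_ix_i<-\frac{k_2}{k_1}$,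 while $\varphi_+$ and $f_+$ are defined on the half space determined by $\sum_{i=1}^n\alpha_ix_i>-\frac{k_2}{k_1}$.
   Context: For semi-Riemannian manifolds $(B,g_B)$, $(F,g_F)$ and a smooth function $f>0$ on $B$, the warped product $B\times_fF$ is the product manifold $B\times F$ with the metric $g_B+f^2g_F$ (pullbacks by the projections being understood). Ricci-flat means that the Ricci tensor vanishes identically. The constant $\alpha$ (without index) is unrelated to the coefficients $\alpha_i$. The base is written $(\mathbb{R}^n,\overline g)$, but it is understood to be the domain on which $\varphi$ and $f$ are defined (for the solutions above, the stated half spaces).
   Formalization: As k, k_1>0 force φ>0 and f increasing in ξ, the literal ''only if'' fails for −φ and for ξ→−ξ; here φ>0 is assumed, and Ricci-flat is equivalent to (φ,f) having the stated form for the coefficients (α_i) or for (−α_i). *)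

(* Defs.v *)
From mathcomp Require Import all_boot all_order all_algebra.
From mathcomp Require Import all_classical all_reals all_analysis.

Set Implicit Arguments.
Unset Strict Implicit.
Unset Printing Implicit Defensive.

Import Order.TTheory GRing.Theory Num.Theory.
Import numFieldNormedType.Exports.

Local Open Scope classical_set_scope.
Local Open Scope ring_scope.

Section LocalCoordinates.
Context {R : realType} {d : nat}.

Definition pderiv (i : 'I_d) (h : 'rV[R]_d -> R) (x : 'rV[R]_d) : R :=
  'D_(delta_mx 0 i) h x.

Fixpoint Ck_on (k : nat) (U : set 'rV[R]_d) (h : 'rV[R]_d -> R) : Prop :=
  if k is k'.+1 then
    (forall x, U x -> differentiable h x) /\
    (forall i, Ck_on k' U (pderiv i h))
  else forall x, U x -> {for x, continuous h}.

(* Meant for an open U. *)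
Definition smooth_on (U : set 'rV[R]_d) (h : 'rV[R]_d -> R) : Prop :=
  forall k, Ck_on k U h.

(* In the next two definitions G x is the matrix (g_ij) of a metric at the
   point with coordinates x. The curvature convention is
     Ric_ij = d_k Gamma^k_ij - d_j Gamma^k_ik
              + Gamma^k_kl Gamma^l_ij - Gamma^k_jl Gamma^l_ik
   (summation over k and l). *)
Definition christoffel (G : 'rV[R]_d -> 'M[R]_d) (k i j : 'I_d)
    (x : 'rV[R]_d) : R :=
  2^-1 * \sum_l invmx (G x) k l *
    (pderiv i (fun y => G y j l) x + pderiv j (fun y => G y i l) x
     - pderiv l (fun y => G y i j) x).

Definition ricci (G : 'rV[R]_d -> 'M[R]_d) (x : 'rV[R]_d) : 'M[R]_d :=
  \matrix_(i, j)
    (\sum_k pderiv k (christoffel G k i j) x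
     - \sum_k pderiv j (christoffel G k i k) x
     + \sum_k \sum_l christoffel G k k l x * christoffel G l i j x
     - \sum_k \sum_l christoffel G k j l x * christoffel G l i k x).

Definition neg_definite_on (g W : 'M[R]_d) : Prop :=
  forall v : 'rV[R]_d, (v <= W)%MS -> v != 0 -> (v *m g *m v^T) 0 0 < 0.

(* The index of a symmetric bilinear form: the largest dimension of a subspace
   (the row space of W) on which it is negative definite. *)
Definition has_index (q : nat) (g : 'M[R]_d) : Prop :=
  (exists2 W : 'M[R]_d, neg_definite_on g W & \rank W = q) /\
  (forall W : 'M[R]_d, neg_definite_on g W -> (\rank W <= q)%N).

End LocalCoordinates.

(* An atlas together with the components of a (0,2)-tensor in each chart.
   Chart i is the map [coord i] restricted to [dom i], with inverse [point i];
   [metric i x] is the matrix of the tensor at [point i x] in the coordinate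
   frame of chart i. The points of the manifold are those of the union of the
   chart domains, so that an open subset of R^n needs no carrier of its own. *)
Record metric_atlas (R : realType) (d : nat) := MetricAtlas {
  ambient : topologicalType ;
  chart : Type ;
  dom : chart -> set ambient ;
  coord : chart -> ambient -> 'rV[R]_d ;
  point : chart -> 'rV[R]_d -> ambient ;
  metric : chart -> 'rV[R]_d -> 'M[R]_d }.

Section SemiRiemannian.
Context {R : realType} {d : nat}.
Variable M : metric_atlas R d.

Definition points : set (ambient M) := \bigcup_i dom i.

Definition cod (i : chart M) : set 'rV[R]_d := coord i @` dom i.

Definition overlap (i j : chart M) : set 'rV[R]_d :=
  coord i @` (dom i `&` dom j).

Definition transition (i j : chart M) : 'rV[R]_d -> 'rV[R]_d :=
  coord j \o point i.

Definition points_space : topologicalType :=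
  set_type points.

Definition smooth_manifold : Prop :=
  (points !=set0 /\ hausdorff_space points_space /\
     @second_countable points_space) /\
  (forall i : chart M,
     [/\ open (dom i), open (cod i),
         forall p, dom i p -> point i (coord i p) = p,
         forall p, dom i p -> {for p, continuous (coord i)} &
         forall x, cod i x -> {for x, continuous (point i)}]) /\
  (forall (i j : chart M) (a : 'I_d),
     smooth_on (overlap i j) (fun x => transition i j x 0 a)).

Definition metric_tensor : Prop :=
  [/\ forall (i : chart M) a b, smooth_on (cod i) (fun x => metric i x a b),
      forall (i : chart M) x, cod i x ->
        (metric i x)^T = metric i x /\ metric i x \in unitmx,
      forall (i j : chart M) x, overlap i j x ->
        metric i x = jacobian (transition i j) x
          *m metric j (transition i j x) *m (jacobian (transition i j) x)^T &
      exists q, forall (i : chart M) x, cod i x -> has_index q (metric i x)].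

Definition semi_riemannian : Prop := smooth_manifold /\ metric_tensor.

(* The Ricci tensor vanishes iff its components do in each chart. *)
Definition ricci_flat : Prop :=
  forall (i : chart M) x, cod i x -> ricci (@metric R d M i) x = 0.

End SemiRiemannian.

Arguments points {R d} M.

(* The open subset U of R^n with the metric G, in the chart given by the
   identity. *)
Definition open_chart (R : realType) (n : nat) (U : set 'rV[R]_n)
    (G : 'rV[R]_n -> 'M[R]_n) : metric_atlas R n :=
  @MetricAtlas R n 'rV[R]_n unit (fun=> U) (fun=> id) (fun=> id) (fun=> G).

(* The product manifold of B and F, with the product charts, and the metric
   g_B + f^2 g_F. *)
Definition warped_product (R : realType) (n m : nat) (B : metric_atlas R n)
    (f : ambient B -> R) (F : metric_atlas R m) : metric_atlas R (n + m) :=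
  @MetricAtlas R (n + m) (ambient B * ambient F)%type
    (chart B * chart F)%type
    (fun c => dom c.1 `*` dom c.2)
    (fun c p => row_mx (coord c.1 p.1) (coord c.2 p.2))
    (fun c z => (point c.1 (lsubmx z), point c.2 (rsubmx z)))
    (fun c z => block_mx (metric c.1 (lsubmx z)) 0
                  0 (f (point c.1 (lsubmx z)) ^+ 2 *: metric c.2 (rsubmx z))).

Arguments warped_product {R n m} B f F.

Section Data.
Context {R : realType}.

Definition smooth_on_line (I : set R) (h : R -> R) : Prop :=
  forall (k : nat) (t : R), I t -> derivable (derive1n k h) t 1.

Definition non_constant_on (I : set R) (h : R -> R) : Prop :=
  ~ exists c, forall t, I t -> h t = c.

(* xi = sum_i a_i x_i *)
Definition xi (n : nat) (a x : 'rV[R]_n) : R := \sum_i a 0 i * x 0 i.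

(* The matrix of the metric phi(xi)^-2 g, where g_ij = delta_ij eps_i. *)
Definition conformal_metric (n : nat) (eps a : 'rV[R]_n) (phi : R -> R)
    (x : 'rV[R]_n) : 'M[R]_n :=
  (phi (xi a x) ^+ 2)^-1 *: diag_mx eps.

(* For phi and f defined on I, the base is the set where xi lies in I. *)
Definition base (n : nat) (eps a : 'rV[R]_n) (phi : R -> R) (I : set R) :
    metric_atlas R n :=
  open_chart [set x | I (xi a x)] (conformal_metric eps a phi).

End Data.

Section Solutions.
Context {R : realType}.
Variables n m : nat.

Definition beta : R :=
  Num.sqrt (m%:R * (n%:R - 1) * (m%:R + n%:R - 2)) / (n%:R - 1).

Definition alpha_minus : R := (m%:R + beta) / (n%:R - 2).
Definition alpha_plus : R := (m%:R - beta) / (n%:R - 2).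

Definition phi_minus (k k1 k2 t : R) : R :=
  k * (- beta * (k1 * t + k2)) `^ (- (alpha_minus / beta)).
Definition f_minus (k1 k2 t : R) : R :=
  (- beta * (k1 * t + k2)) `^ (- beta^-1).

Definition phi_plus (k k1 k2 t : R) : R :=
  k * (beta * (k1 * t + k2)) `^ (alpha_plus / beta).
Definition f_plus (k1 k2 t : R) : R :=
  (beta * (k1 * t + k2)) `^ (beta^-1).

(* On U, the functions Phi and f are phi_-(xi) and f_-(xi), or phi_+(xi) and
   f_+(xi), where xi = sum_i a_i x_i, and U lies in the half space where these
   are defined. *)
Definition solution_pair (U : set 'rV[R]_n) (a : 'rV[R]_n)
    (Phi f : 'rV[R]_n -> R) : Prop :=
  exists k k1 k2 : R, [/\ 0 < k, 0 < k1 &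
    (forall x, U x -> [/\ xi a x < - (k2 / k1),
       Phi x = phi_minus k k1 k2 (xi a x) & f x = f_minus k1 k2 (xi a x)])
    \/
    (forall x, U x -> [/\ xi a x > - (k2 / k1),
       Phi x = phi_plus k k1 k2 (xi a x) & f x = f_plus k1 k2 (xi a x)])].

End Solutions.

(* Main.v *)
Require Import Defs.
From mathcomp Require Import all_boot all_order all_algebra.
From mathcomp Require Import all_classical all_reals all_analysis.
From mathcomp Require Import ring lra.

Set Implicit Arguments.
Unset Strict Implicit.
Unset Printing Implicit Defensive.

Import Order.TTheory GRing.Theory Num.Theory.
Import numFieldNormedType.Exports.

Local Open Scope classical_set_scope.
Local Open Scope ring_scope.

(** Write [t] for the value of [xi], and let [u = phi' / phi] and [v = f' / f] be
    the logarithmic derivatives of the two functions. The proof turns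
    Ricci-flatness into ordinary differential equations for [u] and [v], and
    solves these.

    In a product chart every Christoffel symbol of the warped metric is a
    function of [t] times a function of the fiber coordinates. Therefore all the
    derivatives in the Ricci tensor can be computed one factor at a time, and
    the Christoffel symbols of the fiber are only ever differentiated within
    the Ricci tensor of the fiber. The blocks of the Ricci tensor are, with
    [e = sum_i eps_i a_i^2],
      - base/base: [a_i a_j A + e eps_i delta_ij B] (lemma [ricci_bb]),
      - base/fiber: 0 (lemmas [ricci_bf] and [ricci_fb]),
      - fiber/fiber: the Ricci tensor of the fiber minus
        [e phi^2 f^2 C] times its metric (lemma [ricci_ff]),
    where [A], [B], [C] are the left-hand sides of the three equations of
    [warp_system]. Since [e] is not 0 and there are at least two base
    directions, a Ricci-flat fiber gives a Ricci-flat warped product exactly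
    when [A = B = C = 0] (lemma [ricci_flat_warp_system]).

    Put [w = (n-2) u - m v]. The equations [B = C = 0] say [u' = u w] and
    [v' = v w]; but [w] is itself the logarithmic derivative of
    [E = phi^(n-2) f^(-m)], hence [u] and [v] are constant multiples of [E]
    on the whole interval; in particular [v], which is not identically 0,
    has no zero.
    Substituting into [A = 0] leaves a homogeneous quadratic equation for
    [u : v] whose two roots are [alpha_minus] and [alpha_plus]; equivalently
    [w = sigma beta v] with a sign [sigma]. Then [phi / f^alpha] is constant
    and [y = f^(-sigma beta)] has [y' = - sigma beta v y], which is constant
    because [v y] has logarithmic derivative [w - sigma beta v = 0]. So [y] is
    affine, which is the announced formula (lemma [system_power_solution]);
    the converse is a direct differentiation (lemma
    [power_solution_system]).

    The slope [c] of the affine function in [y = - sigma beta (c t + d)] may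
    have either sign. Positive slopes are the solution pairs for [a], negative
    ones those for [- a] (lemma [solution_pair_power]). *)

(** * Logarithmic derivatives *)

Section LogDerivative.
Context {R : realType}.
Implicit Types (h : R -> R) (t L : R).

Lemma derive0_constant (I : set R) h : is_interval I ->
  (forall t, I t -> is_derive t 1 h 0) ->
  forall s t, I s -> I t -> h s = h t.
Proof.
move=> hI dh s t; wlog st : s t / s < t => [hw|] Is It.
  by case: (ltgtP s t) => [/hw ->|/hw ->|->].
have dI x : x \in `[s, t] -> is_derive x 1 h 0.
  by rewrite in_itv /= => /hI-/(_ Is It) /dh.
have ht : {within `[s, t], continuous h}.
  by apply: derivable_within_continuous => x /dI [].
have dh0 x : x \in `]s, t[ -> is_derive x 1 h 0.
  by move=> xst; apply: dI; apply: subset_itv_oo_cc xst.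
have [c _] := @MVT R h (fun=> 0) s t st dh0 ht.
by rewrite mul0r => /eqP; rewrite subr_eq0 => /eqP.
Qed.

(** Products and powers act linearly on logarithmic derivatives, and a function
    is constant when its logarithmic derivative is 0; the whole differential
    system is handled by these rules. Stating the derivative as [h t * L], without a quotient, keeps
    the notion meaningful for the functions [u] and [v], which may vanish. *)
Definition has_logder h t L := is_derive t 1 h (h t * L).

Definition logder h t := derive1 h t / h t.

Lemma logderP h t : derivable h t 1 -> h t != 0 -> has_logder h t (logder h t).
Proof.
move=> dh h0; apply: DeriveDef => //.
by rewrite -derive1E /logder mulrC divfK.
Qed.

Lemma logderE h t L : h t != 0 -> has_logder h t L -> logder h t = L.
Proof.
by move=> h0 [_ e]; rewrite /logder derive1E e mulrAC divff ?mul1r.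
Qed.

Lemma has_logderM h1 h2 t L1 L2 : has_logder h1 t L1 -> has_logder h2 t L2 ->
  has_logder (fun s => h1 s * h2 s) t (L1 + L2).
Proof.
move=> d1 d2; apply: (is_derive_eq (is_deriveM d1 d2)).
by rewrite /GRing.scale /=; ring.
Qed.

Lemma has_logderV h t L : h t != 0 -> has_logder h t L ->
  has_logder (fun s => (h s)^-1) t (- L).
Proof.
move=> h0 d; apply: (is_derive_eq (is_deriveV h0 d)).
by rewrite /GRing.scale /=; field.
Qed.

Lemma has_logder_powR h t L p : 0 < h t -> has_logder h t L ->
  has_logder (fun s => h s `^ p) t (p * L).
Proof.
move=> h0 d.
apply: (is_derive_eq (is_derive1_comp (is_derive1_powR p h0) d)).
have E : h t `^ (p - 1) = h t `^ p / h t.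
  by rewrite powRB ?(gt_eqF h0) ?implybT // powRr1 ?ltW.
rewrite E.
by field; rewrite gt_eqF.
Qed.

Lemma has_logder_near h1 h2 t L : (\forall s \near t, h1 s = h2 s) ->
  has_logder h1 t L -> has_logder h2 t L.
Proof.
move=> e d; rewrite /has_logder -(nbhs_singleton e).
exact: near_eq_is_derive d.
Qed.

Lemma has_logder0_constant (I : set R) h : is_interval I ->
  (forall t, I t -> has_logder h t 0) ->
  forall s t, I s -> I t -> h s = h t.
Proof.
move=> hI dh; apply: derive0_constant => // t /dh.
by rewrite /has_logder mulr0.
Qed.

End LogDerivative.

Lemma derivable_logder (R : realType) (h : R -> R) (t : R) :
  derivable h t 1 -> derivable (derive1 h) t 1 -> h t != 0 ->
  derivable (logder h) t 1.
Proof. move=> d1 d2 h0; exact: (derivableM d2 (derivableV h0 d1)). Qed.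

(** * The differential system *)

Section System.
Context {R : realType}.
Variables n m : nat.
Hypotheses (n_ge3 : (3 <= n)%N) (m_ge2 : (2 <= m)%N).

Local Notation N := (n%:R : R).
Local Notation M := (m%:R : R).
Local Notation beta := (@beta R n m).

Lemma dim_bounds : 3 <= N /\ 2 <= M.
Proof. by rewrite !ler_nat. Qed.

(** The vanishing of [A], [B] and [C], expressed through [u] and [v]; second
    derivatives of [phi] and [f] enter as [u' + u^2] and [v' + v^2]. *)
Definition warp_system (u v : R -> R) (t : R) : Prop :=
  [/\ (N - 2) * (derive1 u t + u t ^+ 2) - M * (derive1 v t + v t ^+ 2)
        - 2 * M * u t * v t = 0,
      derive1 u t - (N - 2) * u t ^+ 2 + M * u t * v t = 0 &
      derive1 v t - (N - 2) * u t * v t + M * v t ^+ 2 = 0].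

Lemma beta_gt0 : 0 < beta.
Proof.
have [n3 m2] := dim_bounds.
rewrite /Defs.beta divr_gt0 ?sqrtr_gt0 ?mulr_gt0 //; lra.
Qed.

Lemma beta_sqr : (N - 1) * beta ^+ 2 = M * (M + N - 2).
Proof.
have [n3 m2] := dim_bounds.
rewrite /Defs.beta expr_div_n sqr_sqrtr ?mulr_ge0 //; try lra.
by field; lra.
Qed.

(** [alpha_minus] for [sg = 1] and [alpha_plus] for [sg = -1]. *)
Definition alpha_sign (sg : R) : R := (M + sg * beta) / (N - 2).

(** Both families at once: [phi_-], [f_-] for [sg = 1] and [phi_+], [f_+] for
    [sg = -1]. The sign of [c] is left open, so that the solutions of
    both orientations of [xi] have this form. *)
Definition power_solution (I : set R) (phi f : R -> R) (sg k c d : R) : Prop :=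
  forall t, I t -> [/\ 0 < - sg * beta * (c * t + d),
    f t = (- sg * beta * (c * t + d)) `^ (- (sg / beta)) &
    phi t = k * f t `^ alpha_sign sg].

Lemma sign_sqr (sg : R) : sg = 1 \/ sg = -1 -> sg * sg = 1.
Proof. by case=> ->; rewrite ?mulrNN mulr1. Qed.

(** With [y] the affine function, [v = c / y] and [u = alpha c / y], so the
    system reduces to the quadratic equation satisfied by [alpha], in which
    [beta] occurs through its square. *)
Lemma power_solution_system (I : set R) (phi f : R -> R) (sg k c d : R) :
  open I -> sg = 1 \/ sg = -1 -> 0 < k ->
  power_solution I phi f sg k c d ->
  forall t, I t -> warp_system (logder phi) (logder f) t.
Proof.
move=> oI /sign_sqr sg2 k0 H.
have [n3 m2] := dim_bounds.
have b0 := beta_gt0; have b2 := beta_sqr.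
set y := fun t => - sg * beta * (c * t + d).
have nearI t : I t -> \forall s \near t, I s by move=> It; apply: open_nbhs_nbhs; split.
have y0 t : I t -> 0 < y t by case/H.
have dy t : I t -> has_logder y t (- sg * beta * c / y t).
  move=> It; have := y0 t It; rewrite /has_logder => yt0.
  have yE : y = (- sg * beta * c) *: id + cst (- sg * beta * d).
    by apply/funext => s; rewrite /y /= !fctE /GRing.scale /=; ring.
  rewrite {1}yE; apply: is_derive_eq.
  by rewrite addr0 [RHS]mulrC divfK ?gt_eqF // /GRing.scale /= mulr1.
have f0 t : I t -> 0 < f t by move=> It; have [y1 -> _] := H t It; exact: powR_gt0.
have df t : I t -> has_logder f t (c / y t).
  move=> It; have := has_logder_powR (- (sg / beta)) (y0 t It) (dy t It).
  have -> : - (sg / beta) * (- sg * beta * c / y t) = sg * sg * (c / y t).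
    by field; rewrite !gt_eqF ?y0.
  rewrite sg2 mul1r; apply: has_logder_near.
  by have := nearI t It; apply: filterS => s /H [].
have dphi t : I t -> has_logder phi t (alpha_sign sg * (c / y t)).
  move=> It; have := has_logder_powR (alpha_sign sg) (f0 t It) (df t It).
  move=> e; have {}e : has_logder (fun s => k * f s `^ alpha_sign sg) t
      (0 + alpha_sign sg * (c / y t)).
    apply: (has_logderM (h1 := fun=> k)) => //.
    by rewrite /has_logder mulr0; exact: is_derive_cst.
  move: e; rewrite add0r; apply: has_logder_near.
  by have := nearI t It; apply: filterS => s /H [].
have phi0 t : I t -> 0 < phi t.
  by move=> It; have [_ _ ->] := H t It; rewrite mulr_gt0 ?powR_gt0 ?f0.
have lf t : I t -> logder f t = c / y t.
  by move=> It; apply: logderE; [rewrite gt_eqF ?f0|exact: df].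
have lphi t : I t -> logder phi t = alpha_sign sg * (c / y t).
  by move=> It; apply: logderE; [rewrite gt_eqF ?phi0|exact: dphi].
have dcy t : I t -> is_derive t 1 (fun s => c / y s) (sg * beta * (c / y t) ^+ 2).
  move=> It; have yt : y t != 0 by rewrite gt_eqF ?y0.
  have := has_logderV yt (dy t It); rewrite /has_logder => d1.
  have -> : (fun s => c / y s) = c *: (fun s => (y s)^-1) by [].
  by apply: is_derive_eq; rewrite /GRing.scale /=; field.
move=> t It.
have dlf : derive1 (logder f) t = sg * beta * (c / y t) ^+ 2.
  rewrite derive1E; have [_ <-] := dcy t It; apply: near_eq_derive.
  by have := nearI t It; apply: filterS => s /lf.
have dlphi : derive1 (logder phi) t = alpha_sign sg * (sg * beta * (c / y t) ^+ 2).
  have dcyt := dcy t It.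
  have [_ e] := is_deriveZ (alpha_sign sg) dcyt.
  rewrite derive1E -[RHS]e.
  apply: near_eq_derive.
  by have := nearI t It; apply: filterS => s /lphi.
rewrite /warp_system dlf dlphi lf // lphi //.
set V := c / y t.
have -> : alpha_sign sg = (M + sg * beta) / (N - 2) by [].
have n20 : N - 2 != 0 by lra.
have n10 : N - 1 != 0 by lra.
have b2' : beta ^+ 2 = M * (M + N - 2) / (N - 1) by rewrite -b2; field.
have sb : (sg * beta) ^+ 2 = M * (M + N - 2) / (N - 1).
  by rewrite exprMn expr2 sg2 mul1r b2'.
split.
- set s := sg * beta in sb *.
  have -> : (N - 2) * ((M + s) / (N - 2) * (s * V ^+ 2) + ((M + s) / (N - 2) * V) ^+ 2) -
    M * (s * V ^+ 2 + V ^+ 2) - 2 * M * ((M + s) / (N - 2) * V) * V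
   = ((N - 1) * s ^+ 2 - M * (M + N - 2)) * V ^+ 2 / (N - 2) by field.
  by rewrite sb; field; rewrite n20 n10.
- by field.
- by field.
Qed.

(** The quantities [u / E], [v / E], [v y] and [phi f^(-alpha)] below are first
    integrals: each has logarithmic derivative 0. *)
Lemma system_power_solution (I : set R) (phi f : R -> R) :
  is_interval I ->
  (forall t, I t -> [/\ 0 < phi t, 0 < f t, derivable phi t 1 & derivable f t 1]) ->
  (forall t, I t -> derivable (logder phi) t 1 /\ derivable (logder f) t 1) ->
  non_constant_on I f ->
  (forall t, I t -> warp_system (logder phi) (logder f) t) ->
  exists sg k c d : R, [/\ sg = 1 \/ sg = -1, 0 < k, c != 0 &
    power_solution I phi f sg k c d].
Proof.
move=> hI reg reg2 nc sys.
have [n3 m2] := dim_bounds.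
have b0 := beta_gt0; have b2 := beta_sqr.
set u := logder phi; set v := logder f.
pose w t := (N - 2) * u t - M * v t.
have dphi t : I t -> has_logder phi t (u t).
  by case/reg=> p0 _ dp _; apply: logderP; rewrite ?gt_eqF.
have df t : I t -> has_logder f t (v t).
  by case/reg=> _ p0 _ dp; apply: logderP; rewrite ?gt_eqF.
have phi0 t : I t -> 0 < phi t by case/reg.
have f0 t : I t -> 0 < f t by case/reg.
have du t : I t -> has_logder u t (w t).
  move=> It; have [_ e _] := sys t It; have [d _] := reg2 t It.
  apply: DeriveDef => //; rewrite -derive1E -/u; apply/eqP.
  by rewrite -subr_eq0 -[X in _ == X]e; apply/eqP; rewrite /w -/u -/v; ring.
have dv t : I t -> has_logder v t (w t).
  move=> It; have [_ _ e] := sys t It; have [_ d] := reg2 t It.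
  apply: DeriveDef => //; rewrite -derive1E -/u; apply/eqP.
  by rewrite -subr_eq0 -[X in _ == X]e; apply/eqP; rewrite /w -/u -/v; ring.
pose E t := phi t `^ (N - 2) * f t `^ (- M).
have E0 t : I t -> 0 < E t by move=> It; rewrite mulr_gt0 ?powR_gt0 ?phi0 ?f0.
have dE t : I t -> has_logder E t (w t).
  move=> It.
  have := has_logderM (has_logder_powR (N - 2) (phi0 t It) (dphi t It))
    (has_logder_powR (- M) (f0 t It) (df t It)).
  by rewrite mulNr.
(* [u], [v] and [E] have the same logarithmic derivative [w] *)
have multiple_of_E g : (forall t, I t -> has_logder g t (w t)) ->
    exists c, forall t, I t -> g t = c * E t.
  move=> dg; have [->|/set0P [t0 It0]] := eqVneq I set0; first by exists 0.
  exists (g t0 / E t0) => t It.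
  suff -> : g t0 / E t0 = g t / E t by rewrite divfK // gt_eqF ?E0.
  apply: (has_logder0_constant hI (h := fun s => g s / E s)) => // s Is.
  rewrite -(subrr (w s)); apply: has_logderM; first exact: dg.
  by apply: has_logderV; rewrite ?gt_eqF ?E0 //; exact: dE.
have [c1 uE] := multiple_of_E u du; have [c2 vE] := multiple_of_E v dv.
have [t0 It0] : I !=set0.
  by apply/set0P/eqP => I0; apply: nc; exists 0 => t; rewrite I0.
have c20 : c2 != 0.
  apply/eqP => c2z; apply: nc; exists (f t0) => t It.
  apply: (has_logder0_constant hI) => // s Is.
  by have := df s Is; rewrite (vE s Is) c2z mul0r.
(* eliminating u' and v' from the system leaves a quadratic equation *)
have quad : ((N - 2) * c1 - M * c2) ^+ 2 = (beta * c2) ^+ 2.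
  have [e1 e2 e3] := sys t0 It0.
  have Et : E t0 != 0 by rewrite gt_eqF ?E0.
  have n10 : N - 1 != 0 by lra.
  apply: (mulfI (x := (N - 1) * E t0 ^+ 2)); first by rewrite mulf_neq0 ?expf_neq0.
  have -> : (N - 1) * E t0 ^+ 2 * (beta * c2) ^+ 2 = M * (M + N - 2) * (c2 * E t0) ^+ 2.
    by rewrite -b2; ring.
  rewrite -(vE t0 It0).
  have -> : (N - 1) * E t0 ^+ 2 * ((N - 2) * c1 - M * c2) ^+ 2 =
      (N - 1) * ((N - 2) * u t0 - M * v t0) ^+ 2 by rewrite uE // vE //; ring.
  apply/eqP; rewrite -subr_eq0; apply/eqP.
  rewrite -/u -/v in e1 e2 e3.
  transitivity ((N - 2) * ((N - 2) * (derive1 u t0 + u t0 ^+ 2)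
      - M * (derive1 v t0 + v t0 ^+ 2) - 2 * M * u t0 * v t0
      - (N - 2) * (derive1 u t0 - (N - 2) * u t0 ^+ 2 + M * u t0 * v t0)
      + M * (derive1 v t0 - (N - 2) * u t0 * v t0 + M * v t0 ^+ 2))); first ring.
  by rewrite e1 e2 e3; ring.
have [sg sgP c12] : exists2 sg : R, sg = 1 \/ sg = -1 &
    (N - 2) * c1 - M * c2 = sg * beta * c2.
  move/eqP: quad; rewrite eqf_sqr => /orP [] /eqP ->.
    by exists 1; [left|rewrite mul1r].
  by exists (-1); [right|ring].
have n20 : N - 2 != 0 by lra.
have sg2 := sign_sqr sgP.
have wv t : I t -> w t = sg * beta * v t.
  by move=> It; rewrite /w uE // vE // mulrA [M * _]mulrA -mulrBl c12 mulrA.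
have uv t : I t -> u t = alpha_sign sg * v t.
  move=> It; rewrite /alpha_sign; have := wv t It; rewrite /w => e.
  by apply: (mulfI n20); rewrite -(subrK (M * v t) (_ * u t)) e; field.
(* the power of [f] that linearises [v' = sg beta v^2] *)
pose y t := f t `^ (- (sg * beta)).
have y0 t : I t -> 0 < y t by move=> It; rewrite powR_gt0 ?f0.
have dy t : I t -> has_logder y t (- (sg * beta) * v t).
  by move=> It; apply: has_logder_powR; [exact: f0|exact: df].
pose c := v t0 * y t0.
have cE t : I t -> v t * y t = c.
  move=> It; apply: (has_logder0_constant hI (h := fun s => v s * y s)) => // s Is.
  have := has_logderM (dv s Is) (dy s Is).
  by rewrite (wv s Is) mulNr subrr.
have c0 : c != 0.
  rewrite /c vE //; apply: mulf_neq0; first apply: mulf_neq0 => //.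
    by rewrite gt_eqF // E0.
  by rewrite gt_eqF // y0.
have yE t : I t -> y t + sg * beta * c * t = y t0 + sg * beta * c * t0.
  move=> It; apply: (derive0_constant hI (h := fun s => y s + sg * beta * c * s)) => // s Is.
  have := dy s Is; rewrite /has_logder => d.
  have -> : (fun s => y s + sg * beta * c * s) = y + (sg * beta * c) *: id by [].
  apply: (is_derive_eq (is_deriveD d (is_deriveZ _ (is_derive_id s 1)))).
  by rewrite /GRing.scale /= -(cE s Is); ring.
pose d := - sg / beta * (y t0 + sg * beta * c * t0).
have yE' t : I t -> y t = - sg * beta * (c * t + d).
  move=> It; rewrite /d -(yE t It).
  transitivity (sg * sg * (y t + sg * beta * c * t) - sg * beta * c * t).
    by rewrite sg2; ring.
  by field; rewrite gt_eqF.
exists sg, (phi t0 * f t0 `^ (- alpha_sign sg)), c, d; split => //.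
  by rewrite mulr_gt0 ?powR_gt0 ?phi0 ?f0.
move=> t It; rewrite -yE' //; split; first exact: y0.
  rewrite /y -powRrM.
  have -> : - (sg * beta) * - (sg / beta) = sg * sg by field; rewrite gt_eqF.
  by rewrite sg2 powRr1 // ltW ?f0.
have -> : phi t0 * f t0 `^ (- alpha_sign sg) = phi t * f t `^ (- alpha_sign sg).
  apply: (has_logder0_constant hI (h := fun s => phi s * f s `^ (- alpha_sign sg))) => // s Is.
  have := has_logderM (dphi s Is) (has_logder_powR (- alpha_sign sg) (f0 s Is) (df s Is)).
  by rewrite (uv s Is) mulNr subrr.
by rewrite -mulrA -powRD ?(gt_eqF (f0 t It)) ?implybT // addNr powRr0 mulr1.
Qed.

End System.

(** * Partial derivatives *)

Section PartialDerivatives.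
Context {R : realType}.

(** A directional derivative is a limit of the same difference quotients as the
    derivative of the restriction to a line. This makes partial derivatives
    of a function that is constant along a line, or that depends on the fiber
    coordinates alone, computable without any differentiability assumption. *)
Lemma difference_quotient_line d (h : 'rV[R]_d -> R) (v x : 'rV[R]_d) :
  (fun s : R => s^-1 *: ((h \o shift x) (s *: v) - h x)) =
  (fun s : R => s^-1 *:
    (((fun s : R => h (s *: v + x)) \o shift (0 : R)) (s *: (1 : R)) - h (0 *: v + x))).
Proof. by apply/funext => s; rewrite /= scale0r add0r addr0 [s *: 1]mulr1. Qed.

Lemma derive_line d (h : 'rV[R]_d -> R) (v x : 'rV[R]_d) :
  'D_v h x = 'D_1 (fun s : R => h (s *: v + x)) 0.
Proof. by rewrite /derive difference_quotient_line. Qed.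

Lemma derivable_line d (h : 'rV[R]_d -> R) (v x : 'rV[R]_d) :
  derivable h x v -> derivable (fun s : R => h (s *: v + x)) 0 1.
Proof. by rewrite /derivable difference_quotient_line. Qed.

Lemma pderiv_near d (i : 'I_d) (h1 h2 : 'rV[R]_d -> R) x :
  (\forall y \near x, h1 y = h2 y) -> pderiv i h1 x = pderiv i h2 x.
Proof. exact: near_eq_derive. Qed.

Lemma christoffelC d (G : 'rV[R]_d -> 'M[R]_d) (k i j : 'I_d) x :
  (\forall y \near x, (G y)^T = G y) ->
  christoffel G k i j x = christoffel G k j i x.
Proof.
move=> GT; rewrite /christoffel; congr (_ * _); apply: eq_bigr => l _.
congr (_ * _); rewrite [pderiv i _ _ + _]addrC; congr (_ - _).
by apply: pderiv_near; apply: filterS GT => y e; rewrite -{1}e mxE.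
Qed.

End PartialDerivatives.

(** The vector [(eps_i a_i)] is the gradient of [xi] for the metric [diag_mx eps],
    and [xi] takes the nonzero value [sum_i eps_i a_i^2] on it. *)
Lemma xi_surj (R : realType) (n : nat) (eps a : 'rV[R]_n) (t : R) :
  \sum_i eps 0 i * a 0 i ^+ 2 != 0 -> exists x, xi a x = t.
Proof.
move=> e0; exists (\row_i (t / (\sum_i eps 0 i * a 0 i ^+ 2) * (eps 0 i * a 0 i))).
rewrite /xi -[RHS](divfK e0) mulr_sumr; apply: eq_bigr => i _.
by rewrite mxE; ring.
Qed.

(** * Christoffel symbols of the warped metric *)

(** In the names below, the letters [b] and [f] stand for base and fiber
    indices: [christoffel_bff] is the symbol with an upper base index and two
    lower fiber indices, and a further letter tells the direction of
    differentiation. *)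

Section Warped.
Context {R : realType} {n m : nat}.
Variables (eps a : 'rV[R]_n) (phi f : R -> R) (H : 'rV[R]_m -> 'M[R]_m).
Variables (I : set R) (V : set 'rV[R]_m).

Local Notation ls := (lshift m).
Local Notation rs := (@rshift n m).
Local Notation t_ z := (xi a (lsubmx z)).
Local Notation y_ z := (rsubmx z).

Definition warped_metric (z : 'rV[R]_(n + m)) : 'M[R]_(n + m) :=
  block_mx (conformal_metric eps a phi (lsubmx z)) 0
    0 (f (t_ z) ^+ 2 *: H (y_ z)).

Local Notation G := warped_metric.

Definition chart_set : set 'rV[R]_(n + m) := [set z | I (t_ z) /\ V (y_ z)].

Lemma xi_base_line (k : 'I_n) (z : 'rV[R]_(n + m)) (s : R) :
  t_ (s *: delta_mx 0 (ls k) + z) = s * a 0 k + t_ z.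
Proof.
rewrite /xi; transitivity (\sum_i (s * (a 0 i * (i == k)%:R) + a 0 i * lsubmx z 0 i)).
  apply: eq_bigr => i _; rewrite !mxE eqxx /= (inj_eq (@lshift_inj _ _)); ring.
rewrite big_split /= -mulr_sumr (bigD1 k) //= eqxx mulr1 big1 ?addr0 //.
by move=> i /negPf ->; rewrite mulr0.
Qed.

Lemma fiber_base_line (k : 'I_n) (z : 'rV[R]_(n + m)) (s : R) :
  y_ (s *: delta_mx 0 (ls k) + z) = y_ z.
Proof. by apply/rowP => b; rewrite !mxE eqxx /= eq_rlshift mulr0 add0r. Qed.

Lemma xi_fiber_line (b : 'I_m) (z : 'rV[R]_(n + m)) (s : R) :
  t_ (s *: delta_mx 0 (rs b) + z) = t_ z.
Proof.
rewrite /xi; apply: eq_bigr => i _.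
by rewrite !mxE eqxx /= eq_lrshift mulr0 add0r.
Qed.

Lemma fiber_fiber_line (b : 'I_m) (z : 'rV[R]_(n + m)) (s : R) :
  y_ (s *: delta_mx 0 (rs b) + z) = s *: delta_mx 0 b + y_ z.
Proof. by apply/rowP => c; rewrite !mxE eqxx /= (inj_eq (@rshift_inj _ _)). Qed.

Lemma pderiv_base (p : R -> R) (q : 'rV[R]_m -> R) (k : 'I_n) (z : 'rV[R]_(n + m)) :
  derivable p (t_ z) 1 ->
  pderiv (ls k) (fun z => p (t_ z) * q (y_ z)) z
  = a 0 k * derive1 p (t_ z) * q (y_ z).
Proof.
move=> dp; rewrite /pderiv derive_line.
set g := (X in derive X _ _).
have -> : g = (fun s => q (y_ z) * (p \o (fun s => s * a 0 k + t_ z)) s).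
  by apply/funext => s; rewrite /g /= xi_base_line fiber_base_line mulrC.
have dl : is_derive (0 : R) 1 (fun s => s * a 0 k + t_ z) (a 0 k).
  have -> : (fun s => s * a 0 k + t_ z) = (a 0 k *: id) + cst (t_ z).
    by apply/funext => s /=; rewrite /= mulrC.
  apply: (is_derive_eq (is_deriveD (is_deriveZ _ (is_derive_id _ _)) (is_derive_cst _ _ _))).
  by rewrite addr0 [_ *: 1]mulr1.
pose l := fun s : R => s * a 0 k + t_ z.
have dp' : is_derive (l 0) 1 p (derive1 p (t_ z)).
  by rewrite /l mul0r add0r derive1E; exact: derivableP.
have [_ e] := is_deriveZ (q (y_ z)) (@is_derive1_comp _ p l 0 _ _ dp' dl).
rewrite [LHS]e /GRing.scale /=; ring.
Qed.

Lemma pderiv_fiber (p : R -> R) (q : 'rV[R]_m -> R) (b : 'I_m) (z : 'rV[R]_(n + m)) :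
  derivable q (y_ z) (delta_mx 0 b) ->
  pderiv (rs b) (fun z => p (t_ z) * q (y_ z)) z
  = p (t_ z) * pderiv b q (y_ z).
Proof.
move=> dq; rewrite /pderiv !derive_line.
set g := (X in derive X _ _ = _).
have -> : g = p (t_ z) *: (fun s => q (s *: delta_mx 0 b + y_ z)).
  by apply/funext => s; rewrite /g /= xi_fiber_line fiber_fiber_line.
have dl := derivable_line dq.
by rewrite deriveZ.
Qed.

Lemma pderiv_fiber_only (q : 'rV[R]_m -> R) (b : 'I_m) (z : 'rV[R]_(n + m)) :
  pderiv (rs b) (fun z => q (y_ z)) z = pderiv b q (y_ z).
Proof.
rewrite /pderiv [LHS]derive_line [RHS]derive_line.
set g := (X in derive X _ _ = _).
suff -> : g = (fun s => q (s *: delta_mx 0 b + y_ z)) by [].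
by apply/funext => s; rewrite /g fiber_fiber_line.
Qed.

Hypotheses (oI : open I) (oV : open V).

Lemma open_chart_set : open chart_set.
Proof.
have -> : chart_set = (fun z => t_ z) @^-1` I `&` (fun z => y_ z) @^-1` V by [].
apply: openI; apply: open_comp => // z _.
  apply: continuous_comp.
    exact/differentiable_continuous/differentiable_lsubmx.
  have -> : xi a = \sum_i (a 0 i *: (fun x : 'rV[R]_n => x 0 i)).
    by apply/funext => x; rewrite fct_sumE.
  apply/differentiable_continuous/differentiable_sum => i.
  exact/differentiableZ/differentiable_coord.
exact/differentiable_continuous/differentiable_rsubmx.
Qed.

Lemma near_chart_set z : chart_set z -> \forall z' \near z, chart_set z'.
Proof.
by move=> Wz; apply: open_nbhs_nbhs; split => //; exact: open_chart_set.
Qed.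

(** The next five lemmas differentiate a function that agrees, near the point,
    with a product of a function of [xi] and a function of the fiber
    coordinates. They apply to the Christoffel symbols, whose formulas
    only hold where the metric is defined. *)
Lemma pderiv_base_near (h : 'rV[R]_(n + m) -> R) (p : R -> R) (q : 'rV[R]_m -> R) :
  (forall z, chart_set z -> h z = p (t_ z) * q (y_ z)) ->
  forall z k, chart_set z -> derivable p (t_ z) 1 ->
  pderiv (ls k) h z = a 0 k * derive1 p (t_ z) * q (y_ z).
Proof.
move=> hE z k Wz dp; rewrite -pderiv_base //; apply: pderiv_near.
by apply: filterS (near_chart_set Wz) => z' /hE.
Qed.

Lemma pderiv_fiber_near (h : 'rV[R]_(n + m) -> R) (p : R -> R) (q : 'rV[R]_m -> R) :
  (forall z, chart_set z -> h z = p (t_ z) * q (y_ z)) ->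
  forall z b, chart_set z -> derivable q (y_ z) (delta_mx 0 b) ->
  pderiv (rs b) h z = p (t_ z) * pderiv b q (y_ z).
Proof.
move=> hE z b Wz dq; rewrite -pderiv_fiber //; apply: pderiv_near.
by apply: filterS (near_chart_set Wz) => z' /hE.
Qed.

Lemma pderiv_near_zero (h : 'rV[R]_(n + m) -> R) :
  (forall z, chart_set z -> h z = 0) ->
  forall z K, chart_set z -> pderiv K h z = 0.
Proof.
move=> hE z K Wz; rewrite (@pderiv_near _ _ _ _ (cst 0)).
  exact: derive_cst.
by apply: filterS (near_chart_set Wz) => z' /hE.
Qed.

Lemma pderiv_fiber_of_base (h : 'rV[R]_(n + m) -> R) (p : R -> R) :
  (forall z, chart_set z -> h z = p (t_ z)) ->
  forall z b, chart_set z -> pderiv (rs b) h z = 0.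
Proof.
move=> hE z b Wz; rewrite (@pderiv_fiber_near _ p (cst 1)) //.
- by rewrite /pderiv derive_cst mulr0.
- by move=> z' /hE ->; rewrite mulr1.
Qed.

Lemma pderiv_of_fiber (h : 'rV[R]_(n + m) -> R) (q : 'rV[R]_m -> R) :
  (forall z, chart_set z -> h z = q (y_ z)) ->
  forall z, chart_set z ->
  (forall k, pderiv (ls k) h z = 0) /\
  (forall b, pderiv (rs b) h z = pderiv b q (y_ z)).
Proof.
move=> hE z Wz; split=> [k|b].
  rewrite (@pderiv_base_near _ (cst 1) q) ?derive1_cst ?mulr0 ?mul0r //.
  by move=> z' /hE ->; rewrite mul1r.
rewrite -pderiv_fiber_only; apply: pderiv_near.
by apply: filterS (near_chart_set Wz) => z' /hE.
Qed.

Hypotheses (heps : forall i, eps 0 i = 1 \/ eps 0 i = -1).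
Hypotheses (phi0 : forall t, I t -> 0 < phi t) (f0 : forall t, I t -> 0 < f t).
Hypotheses (dphi : forall t, I t -> derivable phi t 1).
Hypotheses (df : forall t, I t -> derivable f t 1).
Local Notation u := (logder phi).
Local Notation v := (logder f).
Hypotheses (du : forall t, I t -> derivable u t 1).
Hypotheses (dv : forall t, I t -> derivable v t 1).
Hypothesis symH : forall y, V y -> (H y)^T = H y.
Hypothesis unitH : forall y, V y -> H y \in unitmx.
Hypothesis dH : forall y b c e, V y ->
  derivable (fun y => H y b c) y (delta_mx 0 e).

Lemma eps_sqr i : eps 0 i * eps 0 i = 1.
Proof. by case: (heps i) => ->; rewrite ?mulrNN mulr1. Qed.

Lemma sum_diag p (c : R) (k : 'I_p) (X : 'I_p -> R) :
  \sum_l (c *+ (k == l)) * X l = c * X k.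
Proof.
rewrite (bigD1 k) //= eqxx big1 ?addr0 // => l.
by rewrite eq_sym => /negPf ->; rewrite mul0r.
Qed.

Lemma logder_phi t : I t -> has_logder phi t (u t).
Proof. by move=> It; apply: logderP; rewrite ?gt_eqF ?phi0 //; exact: dphi. Qed.

Lemma logder_f t : I t -> has_logder f t (v t).
Proof. by move=> It; apply: logderP; rewrite ?gt_eqF ?f0 //; exact: df. Qed.

Definition conf_factor (t : R) := (phi t ^+ 2)^-1.
Definition warp_sqr (t : R) := f t ^+ 2.

Lemma conf_factor_logder t : I t -> has_logder conf_factor t (- (u t + u t)).
Proof.
move=> It; apply: has_logderV; first by rewrite expf_neq0 // gt_eqF ?phi0.
exact: (has_logderM (logder_phi It) (logder_phi It)).
Qed.

Lemma warp_sqr_logder t : I t -> has_logder warp_sqr t (v t + v t).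
Proof. by move=> It; exact: (has_logderM (logder_f It) (logder_f It)). Qed.

Lemma metric_bb z i j : G z (ls i) (ls j) = conf_factor (t_ z) * (eps 0 i *+ (i == j)).
Proof. by rewrite /G block_mxEul !mxE. Qed.
Lemma metric_ff z b c : G z (rs b) (rs c) = warp_sqr (t_ z) * H (y_ z) b c.
Proof. by rewrite /G block_mxEdr !mxE. Qed.
Lemma metric_bf z i b : G z (ls i) (rs b) = 0.
Proof. by rewrite /G block_mxEur !mxE. Qed.
Lemma metric_fb z i b : G z (rs b) (ls i) = 0.
Proof. by rewrite /G block_mxEdl !mxE. Qed.

Section AtPoint.
Variable z : 'rV[R]_(n + m).
Hypothesis Wz : chart_set z.
Local Notation t := (t_ z).
Local Notation y := (y_ z).

Let It : I t. Proof. by case: Wz. Qed.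
Let Vy : V y. Proof. by case: Wz. Qed.

Lemma pderiv_metric_bb_b k i j : pderiv (ls k) (fun z => G z (ls i) (ls j)) z =
  a 0 k * (conf_factor t * - (u t + u t)) * (eps 0 i *+ (i == j)).
Proof.
have [d e] := conf_factor_logder It.
rewrite (@pderiv_base_near _ conf_factor (cst (eps 0 i *+ (i == j)))) ?derive1E ?e //.
by move=> z' _; rewrite metric_bb.
Qed.

Lemma pderiv_metric_bb_f b i j : pderiv (rs b) (fun z => G z (ls i) (ls j)) z = 0.
Proof.
apply: (@pderiv_fiber_of_base _ (fun t => conf_factor t * (eps 0 i *+ (i == j)))) => //.
by move=> z' _; rewrite metric_bb.
Qed.

Lemma pderiv_metric_ff_b k b c : pderiv (ls k) (fun z => G z (rs b) (rs c)) z =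
  a 0 k * (warp_sqr t * (v t + v t)) * H y b c.
Proof.
have [d e] := warp_sqr_logder It.
rewrite (@pderiv_base_near _ warp_sqr (fun y => H y b c)) ?derive1E ?e //.
by move=> z' _; rewrite metric_ff.
Qed.

Lemma pderiv_metric_ff_f e b c : pderiv (rs e) (fun z => G z (rs b) (rs c)) z =
  warp_sqr t * pderiv e (fun y => H y b c) y.
Proof.
apply: pderiv_fiber_near => //; last exact: dH.
by move=> z' _; rewrite metric_ff.
Qed.

Lemma pderiv_metric_bf K i b : pderiv K (fun z => G z (ls i) (rs b)) z = 0.
Proof. by apply: pderiv_near_zero => // z' _; rewrite metric_bf. Qed.
Lemma pderiv_metric_fb K i b : pderiv K (fun z => G z (rs b) (ls i)) z = 0.
Proof. by apply: pderiv_near_zero => // z' _; rewrite metric_fb. Qed.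

Definition pderiv_metric := (pderiv_metric_bb_b, pderiv_metric_bb_f,
  pderiv_metric_ff_b, pderiv_metric_ff_f, pderiv_metric_bf, pderiv_metric_fb).

Lemma invmx_diag_eps : diag_mx eps \in unitmx /\ invmx (diag_mx eps) = diag_mx eps.
Proof.
have e1 : diag_mx eps *m diag_mx eps = 1%:M.
  rewrite mulmx_diag; apply/matrixP => i j; rewrite !mxE.
  by case: eqP => [->|_]; rewrite ?eps_sqr.
have [un _] := mulmx1_unit e1; split=> //.
by rewrite -[LHS]mulmx1 -e1 mulKmx.
Qed.

Lemma conf_factor_unit : conf_factor t \is a GRing.unit.
Proof. by rewrite unitfE invr_eq0 expf_neq0 // gt_eqF ?phi0. Qed.
Lemma warp_sqr_unit : warp_sqr t \is a GRing.unit.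
Proof. by rewrite unitfE expf_neq0 // gt_eqF ?f0. Qed.

Lemma invmx_warped_metric : invmx (G z) =
  block_mx ((phi t ^+ 2) *: diag_mx eps) 0 0 ((warp_sqr t)^-1 *: invmx (H y)).
Proof.
have [un inv] := invmx_diag_eps.
have u1 : conf_factor t *: diag_mx eps \in unitmx by rewrite unitmxZ // conf_factor_unit.
have u2 : warp_sqr t *: H y \in unitmx by rewrite unitmxZ ?warp_sqr_unit // unitH.
rewrite /G invmx_block_diag ?block_diag_mx_unit ?u1 ?u2 //.
by rewrite !invmxZ // inv invrK.
Qed.

Lemma christoffel_base k J L : christoffel G (ls k) J L z =
  2^-1 * (phi t ^+ 2 * eps 0 k *
    (pderiv J (fun z => G z L (ls k)) z + pderiv L (fun z => G z J (ls k)) z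
     - pderiv (ls k) (fun z => G z J L) z)).
Proof.
rewrite /christoffel invmx_warped_metric big_split_ord /=; congr (_ * _).
rewrite [X in _ + X]big1 ?addr0; last first.
  by move=> b _; rewrite block_mxEur mxE mul0r.
rewrite -(sum_diag _ k (fun l => pderiv J (fun z => G z L (ls l)) z
  + pderiv L (fun z => G z J (ls l)) z - pderiv (ls l) (fun z => G z J L) z)).
apply: eq_bigr => l _.
by rewrite block_mxEul !mxE -mulrnAr.
Qed.

Lemma christoffel_fiber b J L : christoffel G (rs b) J L z =
  2^-1 * \sum_c (warp_sqr t)^-1 * invmx (H y) b c *
    (pderiv J (fun z => G z L (rs c)) z + pderiv L (fun z => G z J (rs c)) z
     - pderiv (rs c) (fun z => G z J L) z).
Proof.
rewrite /christoffel invmx_warped_metric big_split_ord /=; congr (_ * _).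
rewrite [X in X + _]big1 ?add0r; last first.
  by move=> k _; rewrite block_mxEdl mxE mul0r.
by apply: eq_bigr => c _; rewrite block_mxEdr !mxE.
Qed.

(** The Christoffel symbols of the conformally flat base are [- u] times this
    constant tensor. *)
Definition conf_coef (k i j : 'I_n) : R :=
  a 0 i * (j == k)%:R + a 0 j * (i == k)%:R
  - eps 0 k * a 0 k * (eps 0 i * (i == j)%:R).

Lemma sqr_phi_conf_factor : phi t ^+ 2 * conf_factor t = 1.
Proof. by rewrite divff // expf_neq0 // gt_eqF ?phi0. Qed.

Lemma eps_delta i j : eps 0 j * (eps 0 i *+ (i == j)) = (i == j)%:R.
Proof. by case: eqP => [->|]; rewrite ?eps_sqr ?mulr0. Qed.

Lemma christoffel_bbb k i j : christoffel G (ls k) (ls i) (ls j) z =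
  - u t * conf_coef k i j.
Proof.
rewrite christoffel_base !pderiv_metric /conf_coef.
transitivity (- u t * (phi t ^+ 2 * conf_factor t) * (
  a 0 i * (eps 0 k * (eps 0 j *+ (j == k))) + a 0 j * (eps 0 k * (eps 0 i *+ (i == k)))
  - a 0 k * (eps 0 k * (eps 0 i *+ (i == j))))).
  by field.
by rewrite sqr_phi_conf_factor mulr1 !eps_delta mulr_natr; congr (_ * (_ - _)); ring.
Qed.

Lemma christoffel_bbf k i b : christoffel G (ls k) (ls i) (rs b) z = 0.
Proof. by rewrite christoffel_base !pderiv_metric; ring. Qed.
Lemma christoffel_bfb k i b : christoffel G (ls k) (rs b) (ls i) z = 0.
Proof. by rewrite christoffel_base !pderiv_metric; ring. Qed.
Lemma christoffel_bff k b c : christoffel G (ls k) (rs b) (rs c) z =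
  - (phi t ^+ 2 * warp_sqr t * v t) * (eps 0 k * a 0 k * H y b c).
Proof. by rewrite christoffel_base !pderiv_metric; field. Qed.
Lemma christoffel_fbb b i j : christoffel G (rs b) (ls i) (ls j) z = 0.
Proof. by rewrite christoffel_fiber big1 ?mulr0 // => c _; rewrite !pderiv_metric; ring. Qed.

Lemma sum_invH b c : \sum_d invmx (H y) b d * H y c d = (b == c)%:R.
Proof.
have := mulVmx (unitH Vy) => /matrixP /(_ b c); rewrite !mxE => <-.
by apply: eq_bigr => d _; rewrite -[in X in _ * X = _](symH Vy) [X in _ * X = _]mxE.
Qed.

Lemma christoffel_fbf b i c : christoffel G (rs b) (ls i) (rs c) z =
  v t * (a 0 i * (b == c)%:R).
Proof.
rewrite christoffel_fiber -sum_invH !mulr_sumr; apply: eq_bigr => d _; rewrite !pderiv_metric.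
by field; rewrite -unitfE warp_sqr_unit.
Qed.
Lemma christoffel_ffb b i c : christoffel G (rs b) (rs c) (ls i) z =
  v t * (a 0 i * (b == c)%:R).
Proof.
rewrite christoffel_fiber -sum_invH !mulr_sumr; apply: eq_bigr => d _; rewrite !pderiv_metric.
by field; rewrite -unitfE warp_sqr_unit.
Qed.
Lemma christoffel_fff b c d : christoffel G (rs b) (rs c) (rs d) z = christoffel H b c d y.
Proof.
rewrite christoffel_fiber /christoffel; congr (_ * _).
apply: eq_bigr => e _; rewrite !pderiv_metric.
by field; rewrite -unitfE warp_sqr_unit.
Qed.

End AtPoint.

(** * The Ricci tensor of the warped metric *)

Section Ricci.
Variable z : 'rV[R]_(n + m).
Hypothesis Wz : chart_set z.
Local Notation t := (t_ z).
Local Notation y := (y_ z).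
Local Notation N := (n%:R : R).
Local Notation M := (m%:R : R).

Let It : I t. Proof. by case: Wz. Qed.
Let Vy : V y. Proof. by case: Wz. Qed.

Let u_ : R -> R := u.
Let v_ : R -> R := v.

Lemma pderiv_christoffel_bbb_b l k i j :
  pderiv (ls l) (christoffel G (ls k) (ls i) (ls j)) z =
  - derive1 u t * (a 0 l * conf_coef k i j).
Proof.
rewrite (@pderiv_base_near _ (- u_) (cst (conf_coef k i j))) //.
- rewrite derive1N; last exact: du.
  by rewrite /= mulrN !mulNr mulrCA !mulrA.
- by move=> z' Wz'; rewrite christoffel_bbb.
- exact/derivableN/du.
Qed.

Lemma pderiv_christoffel_bbb_f b k i j :
  pderiv (rs b) (christoffel G (ls k) (ls i) (ls j)) z = 0.
Proof.
apply: (@pderiv_fiber_of_base _ (fun t => - u t * conf_coef k i j)) => //.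
by move=> z' Wz'; rewrite christoffel_bbb.
Qed.

Lemma pderiv_christoffel_bbf K k i b :
  pderiv K (christoffel G (ls k) (ls i) (rs b)) z = 0.
Proof. by apply: pderiv_near_zero => // z' Wz'; rewrite christoffel_bbf. Qed.

Lemma pderiv_christoffel_bfb K k i b :
  pderiv K (christoffel G (ls k) (rs b) (ls i)) z = 0.
Proof. by apply: pderiv_near_zero => // z' Wz'; rewrite christoffel_bfb. Qed.

Lemma pderiv_christoffel_fbb K b i j :
  pderiv K (christoffel G (rs b) (ls i) (ls j)) z = 0.
Proof. by apply: pderiv_near_zero => // z' Wz'; rewrite christoffel_fbb. Qed.

Lemma pderiv_christoffel_fbf_b l b i c :
  pderiv (ls l) (christoffel G (rs b) (ls i) (rs c)) z =
  derive1 v t * (a 0 l * (a 0 i * (b == c)%:R)).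
Proof.
rewrite (@pderiv_base_near _ v_ (cst (a 0 i * (b == c)%:R))) //.
- by rewrite /= [a 0 l * _]mulrC !mulrA.
- by move=> z' Wz'; rewrite christoffel_fbf.
- exact: dv.
Qed.

Lemma pderiv_christoffel_fbf_f e b i c :
  pderiv (rs e) (christoffel G (rs b) (ls i) (rs c)) z = 0.
Proof.
apply: (@pderiv_fiber_of_base _ (fun t => v t * (a 0 i * (b == c)%:R))) => //.
by move=> z' Wz'; rewrite christoffel_fbf.
Qed.

Lemma pderiv_christoffel_ffb_f e b i c :
  pderiv (rs e) (christoffel G (rs b) (rs c) (ls i)) z = 0.
Proof.
apply: (@pderiv_fiber_of_base _ (fun t => v t * (a 0 i * (b == c)%:R))) => //.
by move=> z' Wz'; rewrite christoffel_ffb.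
Qed.

Lemma pderiv_christoffel_bff_b l k b c :
  pderiv (ls l) (christoffel G (ls k) (rs b) (rs c)) z =
  - (phi t ^+ 2 * warp_sqr t * (derive1 v t + 2 * (u t + v t) * v t))
    * (a 0 l * (eps 0 k * a 0 k * H y b c)).
Proof.
pose p : R -> R := fun t => - (phi t * phi t * warp_sqr t * v t).
have dp : is_derive t 1 p
  (- (phi t ^+ 2 * warp_sqr t * (derive1 v t + 2 * (u t + v t) * v t))).
  have dvt : is_derive t 1 v_ (derive1 v t).
    by rewrite derive1E; apply: derivableP; exact: dv.
  have d1 := has_logderM (has_logderM (logder_phi It) (logder_phi It)) (warp_sqr_logder It).
  apply: (is_derive_eq (is_deriveN (is_deriveM d1 dvt))).
  by rewrite /GRing.scale /= /v_; ring.
rewrite (@pderiv_base_near _ p (fun y => eps 0 k * a 0 k * H y b c)) //.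
- by rewrite derive1E; have [_ ->] := dp; rewrite [a 0 l * _]mulrC !mulrA.
- by move=> z' Wz'; rewrite christoffel_bff // /p expr2.
Qed.

Lemma pderiv_christoffel_fff_b l b c d :
  pderiv (ls l) (christoffel G (rs b) (rs c) (rs d)) z = 0.
Proof.
have hE z' : chart_set z' ->
    christoffel G (rs b) (rs c) (rs d) z' = christoffel H b c d (y_ z').
  by move=> Wz'; rewrite christoffel_fff.
have [d1 d2] := pderiv_of_fiber hE Wz; exact: d1.
Qed.

Lemma pderiv_christoffel_fff_f e b c d :
  pderiv (rs e) (christoffel G (rs b) (rs c) (rs d)) z =
  pderiv e (christoffel H b c d) y.
Proof.
have hE z' : chart_set z' ->
    christoffel G (rs b) (rs c) (rs d) z' = christoffel H b c d (y_ z').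
  by move=> Wz'; rewrite christoffel_fff.
have [d1 d2] := pderiv_of_fiber hE Wz; exact: d2.
Qed.

Let e_xi : R := \sum_i eps 0 i * a 0 i ^+ 2.

(** The following contractions of [conf_coef] are those in the
    Ricci tensor of the base. *)
Lemma conf_coefC k i j : conf_coef k i j = conf_coef k j i.
Proof.
rewrite /conf_coef [_ + a 0 j * _]addrC; congr (_ - _ * _).
by rewrite eq_sym; case: eqP => [->|]; rewrite ?mulr0.
Qed.

Lemma sum_delta p (X : 'I_p -> R) k : \sum_l X l * (k == l)%:R = X k.
Proof.
rewrite (bigD1 k) //= eqxx mulr1 big1 ?addr0 // => l.
by rewrite eq_sym => /negPf ->; rewrite mulr0.
Qed.

Lemma contract_conf_coef (X : 'I_n -> R) k j :
  \sum_l conf_coef k j l * X l =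
  a 0 j * X k + (j == k)%:R * (\sum_l a 0 l * X l)
  - eps 0 k * a 0 k * eps 0 j * X j.
Proof.
rewrite /conf_coef -[X k](sum_delta X) -[X j](sum_delta X) !mulr_sumr -big_split /=.
rewrite -sumrB; apply: eq_bigr => l _; rewrite [l == k]eq_sym; ring.
Qed.

Lemma trace_conf_coef i : \sum_k conf_coef k k i = N * a 0 i.
Proof.
rewrite /conf_coef big_split /= sumrN big_split /=.
have -> : \sum_(k < n) a 0 i * (k == k)%:R = N * a 0 i.
  transitivity (\sum_(k < n) a 0 i); last by rewrite sumr_const card_ord mulr_natl.
  by apply: eq_bigr => k _; rewrite eqxx mulr1.
have -> : \sum_k a 0 k * (i == k)%:R = a 0 i by exact: sum_delta.
have -> : \sum_k eps 0 k * a 0 k * (eps 0 k * (k == i)%:R) = a 0 i.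
  rewrite -[RHS](sum_delta (fun k => a 0 k)); apply: eq_bigr => k _.
  transitivity (eps 0 k * eps 0 k * (a 0 k * (k == i)%:R)); first ring.
  by rewrite eps_sqr mul1r eq_sym.
ring.
Qed.

Lemma div_conf_coef i j : \sum_k a 0 k * conf_coef k i j =
  2 * a 0 i * a 0 j - e_xi * (eps 0 i * (i == j)%:R).
Proof.
transitivity (\sum_k (a 0 i * (a 0 k * (j == k)%:R) + a 0 j * (a 0 k * (i == k)%:R)
   - (eps 0 k * a 0 k ^+ 2) * (eps 0 i * (i == j)%:R))).
  by apply: eq_bigr => k _; rewrite /conf_coef; ring.
rewrite sumrB big_split /= -!mulr_sumr -mulr_suml.
rewrite !(sum_delta (fun k => a 0 k)) -/e_xi; ring.
Qed.

(** Contracting over [l] first reduces the quadratic term to the linear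
    contractions above. *)
Lemma quad_conf_coef i j :
  \sum_k \sum_l conf_coef k j l * conf_coef l i k =
  (N + 2) * (a 0 i * a 0 j) - 2 * e_xi * (eps 0 i * (i == j)%:R).
Proof.
transitivity (\sum_k (a 0 j * conf_coef k k i
   + (2 * a 0 i * a 0 k - e_xi * (eps 0 i * (i == k)%:R)) * (j == k)%:R
   - eps 0 j * (conf_coef j i k * (eps 0 k * a 0 k)))).
  apply: eq_bigr => k _; rewrite contract_conf_coef div_conf_coef.
  rewrite [conf_coef k i k]conf_coefC; ring.
rewrite sumrB big_split /= -!mulr_sumr trace_conf_coef sum_delta contract_conf_coef.
have -> : \sum_l a 0 l * (eps 0 l * a 0 l) = e_xi.
  by apply: eq_bigr => l _; ring.
transitivity ((N + 2) * (a 0 i * a 0 j)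
  - e_xi * (eps 0 i * (i == j)%:R) - e_xi * (eps 0 j * (i == j)%:R)
  + (eps 0 i * eps 0 i - 1) * (eps 0 j * eps 0 j) * (a 0 i * a 0 j)
  + (eps 0 j * eps 0 j - 1) * (a 0 i * a 0 j)
  - (eps 0 j * eps 0 j - 1) * (a 0 i * a 0 j)).
  ring.
rewrite !eps_sqr subrr !mul0r; case: (eqVneq i j) => [->|_] /=; ring.
Qed.

Lemma big_block (X : 'I_(n + m) -> R) :
  \sum_K X K = \sum_k X (ls k) + \sum_b X (rs b).
Proof. exact: big_split_ord. Qed.

Lemma trace_christoffel_b l : \sum_K christoffel G K K (ls l) z =
  (M * v t - N * u t) * a 0 l.
Proof.
rewrite big_block.
have -> : \sum_k christoffel G (ls k) (ls k) (ls l) z = - u t * (N * a 0 l).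
  rewrite -trace_conf_coef mulr_sumr; apply: eq_bigr => k _; exact: christoffel_bbb.
have -> : \sum_b christoffel G (rs b) (rs b) (ls l) z = \sum_(b < m) v t * a 0 l.
  by apply: eq_bigr => b _; rewrite christoffel_ffb // eqxx mulr1.
by rewrite sumr_const card_ord -mulr_natl; ring.
Qed.

Lemma trace_christoffel_f b : \sum_K christoffel G K K (rs b) z =
  \sum_c christoffel H c c b y.
Proof.
rewrite [LHS]big_block [X in X + _]big1 ?add0r => [|k _]; last exact: christoffel_bbf.
by apply: eq_bigr => c _; rewrite christoffel_fff.
Qed.

(** The Ricci tensor with every sum over the coordinates split into its base and
    fiber parts. The contracted symbols [Gamma^K_KL] are already evaluated: for
    a base index [L] they are [(m v - n u) a_L], and for a fiber index they are
    those of the fiber. *)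
Lemma ricci_trace J L (s1 s2 s3 s4 s5 s6 s7 s8 : R) :
  \sum_k pderiv (ls k) (christoffel G (ls k) J L) z = s1 ->
  \sum_b pderiv (rs b) (christoffel G (rs b) J L) z = s2 ->
  \sum_k pderiv L (christoffel G (ls k) J (ls k)) z = s3 ->
  \sum_b pderiv L (christoffel G (rs b) J (rs b)) z = s4 ->
  \sum_l a 0 l * christoffel G (ls l) J L z = s5 ->
  \sum_b (\sum_c christoffel H c c b y) * christoffel G (rs b) J L z = s6 ->
  \sum_k \sum_P christoffel G (ls k) L P z * christoffel G P J (ls k) z = s7 ->
  \sum_b \sum_P christoffel G (rs b) L P z * christoffel G P J (rs b) z = s8 ->
  ricci G z J L = s1 + s2 - (s3 + s4) + ((M * v t - N * u t) * s5 + s6) - (s7 + s8).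
Proof.
move=> <- <- <- <- <- <- <- <-.
rewrite mxE; congr (_ - _ + _ - _); try exact: big_block.
rewrite exchange_big /= [LHS]big_block mulr_sumr; congr (_ + _); apply: eq_bigr => l _.
  by rewrite -mulr_suml trace_christoffel_b mulrA.
by rewrite -mulr_suml trace_christoffel_f.
Qed.

Lemma ricci_bb i j : ricci G z (ls i) (ls j) =
  a 0 i * a 0 j * ((N - 2) * (derive1 u t + u t ^+ 2)
     - M * (derive1 v t + v t ^+ 2) - 2 * M * u t * v t)
  + e_xi * (eps 0 i * (i == j)%:R)
    * (derive1 u t - (N - 2) * u t ^+ 2 + M * u t * v t).
Proof.
have E1 : \sum_k pderiv (ls k) (christoffel G (ls k) (ls i) (ls j)) z =
    - derive1 u t * (2 * a 0 i * a 0 j - e_xi * (eps 0 i * (i == j)%:R)).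
  rewrite -div_conf_coef mulr_sumr; apply: eq_bigr => k _; exact: pderiv_christoffel_bbb_b.
have E3 : \sum_k pderiv (ls j) (christoffel G (ls k) (ls i) (ls k)) z =
    - derive1 u t * (a 0 j * (N * a 0 i)).
  rewrite -trace_conf_coef !mulr_sumr; apply: eq_bigr => k _.
  by rewrite pderiv_christoffel_bbb_b conf_coefC.
have E2 : \sum_b pderiv (rs b) (christoffel G (rs b) (ls i) (ls j)) z = 0.
  by rewrite big1 // => b _; rewrite pderiv_christoffel_fbb.
have E4 : \sum_b pderiv (ls j) (christoffel G (rs b) (ls i) (rs b)) z =
    M * derive1 v t * (a 0 i * a 0 j).
  transitivity (\sum_(b < m) derive1 v t * (a 0 i * a 0 j)).
    by apply: eq_bigr => b _; rewrite pderiv_christoffel_fbf_b eqxx mulr1; ring.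
  by rewrite sumr_const card_ord -mulr_natl; ring.
have E5 : \sum_l a 0 l * christoffel G (ls l) (ls i) (ls j) z =
    - u t * (2 * a 0 i * a 0 j - e_xi * (eps 0 i * (i == j)%:R)).
  rewrite -div_conf_coef mulr_sumr; apply: eq_bigr => k _.
  by rewrite christoffel_bbb // mulrCA.
have E6 : \sum_b (\sum_c christoffel H c c b y) * christoffel G (rs b) (ls i) (ls j) z = 0.
  by rewrite big1 // => b _; rewrite christoffel_fbb // mulr0.
have E7 : \sum_k \sum_P christoffel G (ls k) (ls j) P z * christoffel G P (ls i) (ls k) z =
    u t ^+ 2 * ((N + 2) * (a 0 i * a 0 j) - 2 * e_xi * (eps 0 i * (i == j)%:R)).
  rewrite -quad_conf_coef mulr_sumr; apply: eq_bigr => k _.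
  rewrite [LHS]big_block [X in _ + X]big1 ?addr0 
    => [|b _]; last by rewrite christoffel_bbf // mul0r.
  rewrite mulr_sumr; apply: eq_bigr => l _; rewrite !christoffel_bbb //; ring.
have E8 : \sum_b \sum_P christoffel G (rs b) (ls j) P z * christoffel G P (ls i) (rs b) z =
    M * v t ^+ 2 * (a 0 i * a 0 j).
  transitivity (\sum_(b < m) v t ^+ 2 * (a 0 i * a 0 j)).
    apply: eq_bigr => b _.
    rewrite [LHS]big_block [X in X + _]big1 ?add0r 
    => [|k _]; last by rewrite christoffel_fbb // mul0r.
    transitivity (\sum_(c < m) (v t ^+ 2 * (a 0 i * a 0 j)) * (b == c)%:R).
      apply: eq_bigr => c _; rewrite !christoffel_fbf // [c == b]eq_sym.
      by case: eqP => _ /=; ring.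
    exact: sum_delta (fun=> _) _.
  by rewrite sumr_const card_ord -mulr_natl; ring.
rewrite (ricci_trace E1 E2 E3 E4 E5 E6 E7 E8); ring.
Qed.

Lemma christoffelH_sym b c d : christoffel H b c d y = christoffel H b d c y.
Proof.
apply: christoffelC.
have : \forall y' \near y, V y' by apply: open_nbhs_nbhs; split.
by apply: filterS => y' /symH.
Qed.

(** Only two terms survive, both equal to [v a_i] times the contracted
    Christoffel symbol of the fiber, with opposite signs; symmetry of the
    Christoffel symbols of the fiber is needed to see that they agree. *)
Lemma ricci_bf i b : ricci G z (ls i) (rs b) = 0.
Proof.
have E1 : \sum_k pderiv (ls k) (christoffel G (ls k) (ls i) (rs b)) z = 0.
  by rewrite big1 // => k _; exact: pderiv_christoffel_bbf.
have E2 : \sum_c pderiv (rs c) (christoffel G (rs c) (ls i) (rs b)) z = 0.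
  by rewrite big1 // => c _; exact: pderiv_christoffel_fbf_f.
have E3 : \sum_k pderiv (rs b) (christoffel G (ls k) (ls i) (ls k)) z = 0.
  by rewrite big1 // => k _; exact: pderiv_christoffel_bbb_f.
have E4 : \sum_c pderiv (rs b) (christoffel G (rs c) (ls i) (rs c)) z = 0.
  by rewrite big1 // => c _; exact: pderiv_christoffel_fbf_f.
have E5 : \sum_l a 0 l * christoffel G (ls l) (ls i) (rs b) z = 0.
  by rewrite big1 // => l _; rewrite christoffel_bbf // mulr0.
have E6 : \sum_d (\sum_c christoffel H c c d y) * christoffel G (rs d) (ls i) (rs b) z
    = v t * a 0 i * \sum_c christoffel H c c b y.
  rewrite -(sum_delta (fun d => \sum_c christoffel H c c d y)) mulr_sumr.
  apply: eq_bigr => d _; rewrite christoffel_fbf // [b == d]eq_sym; ring.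
have E7 : \sum_k \sum_P christoffel G (ls k) (rs b) P z * christoffel G P (ls i) (ls k) z = 0.
  rewrite big1 // => k _; rewrite [LHS]big_block !big1 ?addr0 // => [c _|l _].
    by rewrite christoffel_fbb // mulr0.
  by rewrite christoffel_bfb // mul0r.
have E8 : \sum_c \sum_P christoffel G (rs c) (rs b) P z * christoffel G P (ls i) (rs c) z
    = v t * a 0 i * \sum_c christoffel H c c b y.
  rewrite mulr_sumr; apply: eq_bigr => c _.
  rewrite [LHS]big_block [X in X + _]big1 ?add0r => [|l _]; last first.
    by rewrite christoffel_ffb // christoffel_bbf // mulr0.
  rewrite -(sum_delta (fun d => christoffel H d d b y)) mulr_sumr.
  apply: eq_bigr => d _; rewrite christoffel_fff // christoffel_fbf //.
  rewrite [c == d]eq_sym christoffelH_sym.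
  by case: eqP => [->|_] /=; ring.
rewrite (ricci_trace E1 E2 E3 E4 E5 E6 E7 E8); ring.
Qed.

Lemma ricci_fb i b : ricci G z (rs b) (ls i) = 0.
Proof.
have E1 : \sum_k pderiv (ls k) (christoffel G (ls k) (rs b) (ls i)) z = 0.
  by rewrite big1 // => k _; exact: pderiv_christoffel_bfb.
have E2 : \sum_c pderiv (rs c) (christoffel G (rs c) (rs b) (ls i)) z = 0.
  by rewrite big1 // => c _; exact: pderiv_christoffel_ffb_f.
have E3 : \sum_k pderiv (ls i) (christoffel G (ls k) (rs b) (ls k)) z = 0.
  by rewrite big1 // => k _; exact: pderiv_christoffel_bfb.
have E4 : \sum_c pderiv (ls i) (christoffel G (rs c) (rs b) (rs c)) z = 0.
  by rewrite big1 // => c _; exact: pderiv_christoffel_fff_b.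
have E5 : \sum_l a 0 l * christoffel G (ls l) (rs b) (ls i) z = 0.
  by rewrite big1 // => l _; rewrite christoffel_bfb // mulr0.
have E6 : \sum_d (\sum_c christoffel H c c d y) * christoffel G (rs d) (rs b) (ls i) z
    = v t * a 0 i * \sum_c christoffel H c c b y.
  rewrite -(sum_delta (fun d => \sum_c christoffel H c c d y)) mulr_sumr.
  apply: eq_bigr => d _; rewrite christoffel_ffb // [b == d]eq_sym; ring.
have E7 : \sum_k \sum_P christoffel G (ls k) (ls i) P z * christoffel G P (rs b) (ls k) z = 0.
  rewrite big1 // => k _; rewrite [LHS]big_block !big1 ?addr0 // => [c _|l _].
    by rewrite christoffel_bbf // mul0r.
  by rewrite christoffel_bfb // mulr0.
have E8 : \sum_c \sum_P christoffel G (rs c) (ls i) P z * christoffel G P (rs b) (rs c) z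
    = v t * a 0 i * \sum_c christoffel H c c b y.
  rewrite mulr_sumr; apply: eq_bigr => c _.
  rewrite [LHS]big_block [X in X + _]big1 ?add0r => [|l _]; last first.
    by rewrite christoffel_fbb // mul0r.
  rewrite -(sum_delta (fun d => christoffel H d d b y)) mulr_sumr.
  apply: eq_bigr => d _; rewrite christoffel_fff // christoffel_fbf //.
  rewrite [c == d]eq_sym christoffelH_sym.
  by case: eqP => [->|_] /=; ring.
rewrite (ricci_trace E1 E2 E3 E4 E5 E6 E7 E8); ring.
Qed.

Lemma ricci_ff b c : ricci G z (rs b) (rs c) =
  ricci H y b c - e_xi * (phi t ^+ 2 * warp_sqr t) * H y b c *
    (derive1 v t - (N - 2) * u t * v t + M * v t ^+ 2).
Proof.
set p := phi t ^+ 2 * warp_sqr t.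
pose s2 := \sum_d pderiv d (christoffel H d b c) y.
pose s4 := \sum_d pderiv c (christoffel H d b d) y.
pose s6 := \sum_k \sum_l christoffel H k k l y * christoffel H l b c y.
pose s8 := \sum_k \sum_l christoffel H k c l y * christoffel H l b k y.
have E1 : \sum_k pderiv (ls k) (christoffel G (ls k) (rs b) (rs c)) z =
    - (p * (derive1 v t + 2 * (u t + v t) * v t)) * (e_xi * H y b c).
  rewrite mulr_suml mulr_sumr; apply: eq_bigr => k _.
  by rewrite pderiv_christoffel_bff_b -/p; ring.
have E2 : \sum_d pderiv (rs d) (christoffel G (rs d) (rs b) (rs c)) z = s2.
  by apply: eq_bigr => d _; exact: pderiv_christoffel_fff_f.
have E3 : \sum_k pderiv (rs c) (christoffel G (ls k) (rs b) (ls k)) z = 0.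
  by rewrite big1 // => k _; rewrite pderiv_christoffel_bfb.
have E4 : \sum_d pderiv (rs c) (christoffel G (rs d) (rs b) (rs d)) z = s4.
  by apply: eq_bigr => d _; exact: pderiv_christoffel_fff_f.
have E5 : \sum_l a 0 l * christoffel G (ls l) (rs b) (rs c) z =
    - (p * v t) * (e_xi * H y b c).
  rewrite mulr_suml mulr_sumr; apply: eq_bigr => k _.
  by rewrite christoffel_bff // -/p; ring.
have E6 : \sum_d (\sum_e christoffel H e e d y) * christoffel G (rs d) (rs b) (rs c) z = s6.
  rewrite [RHS]exchange_big /=; apply: eq_bigr => d _.
  by rewrite mulr_suml; apply: eq_bigr => e _; rewrite christoffel_fff.
have E7 : \sum_k \sum_P christoffel G (ls k) (rs c) P z * christoffel G P (rs b) (ls k) z =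
    - (p * v t ^+ 2) * (e_xi * H y b c).
  rewrite mulr_suml mulr_sumr; apply: eq_bigr => k _.
  rewrite [LHS]big_block [X in X + _]big1 ?add0r 
    => [|l _]; last by rewrite christoffel_bfb // mul0r.
  rewrite -[in X in _ * (_ * X)](symH Vy) [X in _ * (_ * X)]mxE.
  rewrite -(sum_delta (fun d => H y c d)) !mulr_sumr; apply: eq_bigr => d _.
  by rewrite christoffel_bff // christoffel_ffb // -/p [d == b]eq_sym; ring.
have E8 : \sum_d \sum_P christoffel G (rs d) (rs c) P z * christoffel G P (rs b) (rs d) z =
    - (p * v t ^+ 2) * (e_xi * H y b c)
    + s8.
  under eq_bigr => d _ do rewrite big_block.
  rewrite big_split /=; congr (_ + _); last first.
    by apply: eq_bigr => d _; apply: eq_bigr => e _; rewrite !christoffel_fff.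
  rewrite exchange_big /= mulr_suml mulr_sumr; apply: eq_bigr => k _.
  rewrite -(sum_delta (fun d => H y b d)) !mulr_sumr; apply: eq_bigr => d _.
  by rewrite christoffel_bff // christoffel_ffb // -/p [d == c]eq_sym; ring.
rewrite (ricci_trace E1 E2 E3 E4 E5 E6 E7 E8).
have -> : ricci H y b c = s2 - s4 + s6 - s8 by rewrite mxE.
clear; move: s2 s4 s6 s8 e_xi => s2 s4 s6 s8 e; ring.
Qed.

End Ricci.

Local Notation e_ := (\sum_i eps 0 i * a 0 i ^+ 2).

(** Necessity uses two base directions [i <> j] with [a_i <> 0]. The entry
    [(i, j)] gives [a_j A = 0]; if [A <> 0] then [a_j = 0], so the entry [(j, j)]
    gives [B = 0], and the entry [(i, i)] then gives [A = 0] after all. *)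
Lemma ricci_flat_warp_system : (2 <= n)%N -> (1 <= m)%N -> e_ != 0 ->
  V !=set0 -> (forall y, V y -> ricci H y = 0) ->
  (forall z, chart_set z -> ricci G z = 0) <->
  (forall t, I t -> warp_system n m u v t).
Proof.
move=> n2 m1 e0 [y0 Vy0] flatH; split=> [flatG t It|sys z Wz].
  have [x xt] := xi_surj t e0.
  pose z := row_mx x y0.
  have Wz : chart_set z by rewrite /chart_set /= row_mxKl row_mxKr xt.
  have zt : t_ z = t by rewrite row_mxKl.
  have yz : y_ z = y0 by rewrite row_mxKr.
  have [i ai] : exists i, a 0 i != 0.
    apply/not_existsP => a0; case/eqP: e0; rewrite big1 // => i _.
    by have /negP/negPn/eqP -> := a0 i; rewrite expr0n mulr0.
  have [j ij] : exists j, j != i.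
    have : (1 < #|'I_n|)%N by rewrite card_ord.
    case/card_gt1P => j [k [_ _ jk]].
    by case: (eqVneq j i) => [<-|ji]; [exists k; rewrite eq_sym|exists j].
  have rb k l : ricci G z (ls k) (ls l) = 0 by rewrite flatG // mxE.
  have eps0 k : eps 0 k != 0 by case: (heps k) => ->; rewrite ?oppr_eq0 oner_eq0.
  have := (rb i j, rb i i, rb j j); rewrite !ricci_bb // zt !eqxx [i == j]eq_sym (negPf ij).
  set A := _ - _ - _; set B := _ - _ + _; rewrite !mulr0 !mulr1 mul0r addr0.
  move=> [[ijA iiA] jjB].
  have [A0 B0] : A = 0 /\ B = 0.
    have [A0|A0] := eqVneq A 0.
      split=> //; move: iiA; rewrite A0 mulr0 add0r => /eqP.
      by rewrite !mulf_eq0 (negPf e0) (negPf (eps0 i)) => /eqP.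
    have aj : a 0 j = 0.
      by move/eqP: ijA; rewrite !mulf_eq0 (negPf ai) (negPf A0) orbF => /eqP.
    have B0 : B = 0.
      move: jjB; rewrite aj !mul0r add0r => /eqP.
      by rewrite !mulf_eq0 (negPf e0) (negPf (eps0 j)) => /eqP.
    move: iiA; rewrite B0 mulr0 addr0 => /eqP.
    by rewrite !mulf_eq0 (negPf ai) => /eqP.
  split=> //.
  have [b [c Hbc]] : exists b c, H y0 b c != 0.
    apply: contrapT => h; have := unitH Vy0.
    have -> : H y0 = 0.
      apply/matrixP => b c; rewrite mxE; apply/eqP/negPn/negP => hbc.
      by apply: h; exists b, c.
    move/mulmxV; rewrite mul0mx => /matrixP /(_ (Ordinal m1) (Ordinal m1)).
    by rewrite !mxE eqxx => /eqP; rewrite eq_sym oner_eq0.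
  have : ricci G z (rs b) (rs c) = 0 by rewrite flatG // mxE.
  rewrite ricci_ff // zt yz flatH // mxE sub0r => /eqP.
  have phi_n0 : phi t ^+ 2 != 0 by rewrite expf_neq0 // gt_eqF ?phi0.
  have f_n0 : warp_sqr t != 0 by rewrite expf_neq0 // gt_eqF ?f0.
  rewrite oppr_eq0 mulf_eq0 => /orP [|/eqP //].
  by rewrite mulf_eq0 (negPf Hbc) orbF mulf_eq0 (negPf e0) mulf_eq0
    (negPf phi_n0) (negPf f_n0).
have [It Vy] := Wz; have [A0 B0 C0] := sys _ It.
apply/matrixP => K L; rewrite [RHS]mxE.
case: (split_ordP K) => k ->; case: (split_ordP L) => l ->.
- by rewrite ricci_bb // A0 B0 !mulr0 addr0.
- exact: ricci_bf.
- exact: ricci_fb.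
- by rewrite ricci_ff // C0 flatH // mxE mulr0 subr0.
Qed.

End Warped.

(** * Solution pairs *)

Section SolutionPairs.
Context {R : realType} {n m : nat}.
Hypotheses (n_ge3 : (3 <= n)%N) (m_ge2 : (2 <= m)%N).
Variables (a b : 'rV[R]_n) (tau : R) (U : set 'rV[R]_n) (I : set R).
Variables (phi f : R -> R).
Hypotheses (tau2 : tau * tau = 1) (xib : forall x, xi b x = tau * xi a x).
Hypothesis UI : forall x, U x -> I (xi a x).
Hypothesis IU : forall t, I t -> exists2 x, U x & xi a x = t.

Let rescale (c t : R) : c * tau * (tau * t) = c * t.
Proof. by rewrite mulrA -[c * tau * tau]mulrA tau2 mulr1. Qed.

(** The vector [b] is [a] or [- a], according to the sign [tau]. As
    [c t = (c tau) (tau t)], the requirement [k1 > 0] for [b] means that the slope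
    [c] has the sign of [tau]. *)
Lemma solution_pair_power :
  solution_pair m U b (phi \o xi a) (f \o xi a) <->
  exists sg k c d : R, [/\ sg = 1 \/ sg = -1, 0 < k, 0 < c * tau &
    power_solution n m I phi f sg k c d].
Proof.
have b0 := @beta_gt0 R _ _ n_ge3 m_ge2.
have bV : beta n m / beta n m = 1 :> R by rewrite divff // gt_eqF.
have half (k1 k2 s : R) : 0 < k1 -> (s < - (k2 / k1)) = (k1 * s + k2 < 0).
  by move=> k10; rewrite -mulNr ltr_pdivlMr // -subr_lt0 opprK mulrC.
have half' (k1 k2 s : R) : 0 < k1 -> (- (k2 / k1) < s) = (0 < k1 * s + k2).
  by move=> k10; rewrite -mulNr ltr_pdivrMr // -subr_gt0 opprK mulrC.
have fm (k k1 k2 s : R) :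
    phi_minus n m k k1 k2 s = k * f_minus n m k1 k2 s `^ alpha_sign n m 1.
  rewrite /phi_minus /f_minus -powRrM /alpha_minus /alpha_sign mul1r.
  by congr (_ * _ `^ _); rewrite mulNr mulrC.
have fp (k k1 k2 s : R) :
    phi_plus n m k k1 k2 s = k * f_plus n m k1 k2 s `^ alpha_sign n m (-1).
  rewrite /phi_plus /f_plus -powRrM /alpha_plus /alpha_sign mulN1r.
  by congr (_ * _ `^ _); rewrite mulrC.
split=> [[k [k1 [k2 [k0 k10 [] H]]]]|[sg [k [c [d [[] -> k0 ct0 H]]]]]].
- exists 1, k, (k1 * tau), k2; split; [by left|by []|by rewrite -mulrA tau2 mulr1|].
  move=> t /IU [x Ux xt]; have [h1 h2 h3] := H x Ux.
  have e : k1 * tau * t + k2 = k1 * xi b x + k2 by rewrite xib xt mulrA.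
  rewrite e; split.
  + by rewrite mulN1r nmulr_rgt0 ?oppr_lt0 // -half.
  + by rewrite -xt [LHS]h3 /f_minus mulN1r div1r.
  + by rewrite -xt [LHS]h2 fm -h3.
- exists (-1), k, (k1 * tau), k2; split; [by right|by []|by rewrite -mulrA tau2 mulr1|].
  move=> t /IU [x Ux xt]; have [h1 h2 h3] := H x Ux.
  have e : k1 * tau * t + k2 = k1 * xi b x + k2 by rewrite xib xt mulrA.
  rewrite e opprK mul1r; split.
  + by rewrite pmulr_rgt0 // -half'.
  + by rewrite -xt [LHS]h3 /f_plus mulN1r opprK.
  + by rewrite -xt [LHS]h2 fp -h3.
- exists k, (c * tau), d; split => //; left=> x Ux.
  have [h1 h2 h3] := H _ (UI Ux).
  have e : c * tau * xi b x + d = c * xi a x + d by rewrite xib rescale.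
  have h2' : (f \o xi a) x = f_minus n m (c * tau) d (xi b x).
    by rewrite /f_minus e [LHS]h2 mulN1r div1r.
  rewrite fm -h2' half // e; split=> //.
  by move: h1; rewrite mulN1r nmulr_rgt0 ?oppr_lt0.
- exists k, (c * tau), d; split => //; right=> x Ux.
  have [h1 h2 h3] := H _ (UI Ux).
  have e : c * tau * xi b x + d = c * xi a x + d by rewrite xib rescale.
  have h2' : (f \o xi a) x = f_plus n m (c * tau) d (xi b x).
    by rewrite /f_plus e [LHS]h2 mulN1r !opprK mul1r.
  rewrite fp -h2' half' // e; split=> //.
  by move: h1; rewrite opprK mul1r pmulr_rgt0.
Qed.

End SolutionPairs.

Theorem theorem1p4 (R : realType) (n m : nat) (hn : (3 <= n)%N)
    (hm : (2 <= m)%N)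
    (eps a : 'rV[R]_n) (i0 : 'I_n)
    (heps : forall i, eps 0 i = 1 \/ eps 0 i = -1)
    (ha : \sum_i eps 0 i * a 0 i ^+ 2 = eps 0 i0)
    (I : set R) (hIopen : open I) (hIint : is_interval I)
    (phi f : R -> R)
    (hphi : smooth_on_line I phi) (hf : smooth_on_line I f)
    (hphinc : non_constant_on I phi) (hfnc : non_constant_on I f)
    (hphi0 : forall t, I t -> 0 < phi t) (hf0 : forall t, I t -> 0 < f t)
    (F : metric_atlas R m) (hF : semi_riemannian F) (hFflat : ricci_flat F) :
  let B := base eps a phi I in
  let M := warped_product B (f \o xi a) F in
  (* phi(xi) and f(xi), as functions on B, determine the linear form xi only
     up to sign *)
  ricci_flat M <->
    solution_pair m (points B) a (phi \o xi a) (f \o xi a) \/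
    solution_pair m (points B) (- a) (phi \o xi a) (f \o xi a).
Proof.
move=> B M.
have e0 : \sum_i eps 0 i * a 0 i ^+ 2 != 0.
  by rewrite ha; case: (heps i0) => ->; rewrite ?oppr_eq0 oner_eq0.
have dphi t : I t -> derivable phi t 1 by exact: (hphi 0%N).
have df t : I t -> derivable f t 1 by exact: (hf 0%N).
have du t : I t -> derivable (logder phi) t 1.
  move=> It; apply: derivable_logder; [exact: dphi|exact: (hphi 1%N)|].
  by rewrite gt_eqF ?hphi0.
have dv t : I t -> derivable (logder f) t 1.
  move=> It; apply: derivable_logder; [exact: df|exact: (hf 1%N)|].
  by rewrite gt_eqF ?hf0.
have [[[[p0 [j0 _ j0p0]] _] [charts _]] [smoothH symunitH _ _]] := hF.
have oV (j : chart F) : open (cod j) by case: (charts j).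
have symH (j : chart F) y : cod j y -> (metric j y)^T = metric j y by case/symunitH.
have unitH (j : chart F) y : cod j y -> metric j y \in unitmx by case/symunitH.
have dH (j : chart F) y b c e : cod j y ->
    derivable (fun y => metric j y b c) y (delta_mx 0 e).
  by move=> Vy; apply: diff_derivable; have [+ _] := smoothH j b c 1%N; apply.
have codM (c : chart M) z : cod c z <-> chart_set a I (cod c.2) z.
  split=> [[p [pB pF] <-]|[Iz [q Fq qz]]].
    by rewrite /chart_set /= row_mxKl row_mxKr; split=> //; exists p.2.
  exists (lsubmx z, q); first by split.
  by rewrite /= qz hsubmxK.
have flat_system j : (exists p, dom j p) ->
    (forall z, chart_set a I (cod j) z -> ricci (@metric R _ M (tt, j)) z = 0) <->
    (forall t, I t -> warp_system n m (logder phi) (logder f) t).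
  move=> [p Fp]; apply: (ricci_flat_warp_system hIopen (oV j) heps hphi0 hf0
    dphi df du dv (@symH j) (@unitH j) (@dH j)) => //.
  - exact: ltnW.
  - exact: ltnW.
  - by exists (Defs.coord j p), p.
  - exact: hFflat.
have -> : ricci_flat M <->
    (forall t, I t -> warp_system n m (logder phi) (logder f) t).
  split=> [flatM|sys [[] j] z /codM Wz].
    apply/(flat_system j0); first by exists p0.
    by move=> z Wz; apply: (flatM (tt, j0)); apply/codM.
  have domj : exists p, dom j p by case: Wz => _ [p Fp _]; exists p.
  exact: (flat_system j domj).2 sys z Wz.
have BI x : points B x -> I (xi a x) by case.
have IB t : I t -> exists2 x, points B x & xi a x = t.
  move=> It; have [x xt] := xi_surj t e0; exists x => //.
  by exists tt => //=; rewrite xt.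
have xiN x : xi (- a) x = -1 * xi a x.
  by rewrite /xi mulr_sumr; apply: eq_bigr => i _; rewrite mxE; ring.
have xi1 x : xi a x = 1 * xi a x by rewrite mul1r.
have sqr1 : (1 : R) * 1 = 1 by rewrite mulr1.
have sqrN1 : (-1 : R) * -1 = 1 by rewrite mulrNN mulr1.
rewrite (solution_pair_power hn hm phi f sqr1 xi1 BI IB).
rewrite (solution_pair_power hn hm phi f sqrN1 xiN BI IB).
split=> [sys|].
  have reg t : I t ->
      [/\ 0 < phi t, 0 < f t, derivable phi t 1 & derivable f t 1].
    by move=> It; split; [exact: hphi0|exact: hf0|exact: dphi|exact: df].
  have reg' t : I t -> derivable (logder phi) t 1 /\ derivable (logder f) t 1.
    by move=> It; split; [exact: du|exact: dv].
  have [sg [k [c [d [sg1 k0 c0 H]]]]] :=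
    system_power_solution hn hm hIint reg reg' hfnc sys.
  have [c1|c1] : 0 < c \/ c < 0 by apply/orP; rewrite orbC -neq_lt.
    by left; exists sg, k, c, d; rewrite mulr1.
  by right; exists sg, k, c, d; rewrite mulrN1 oppr_gt0.
by case=> - [sg [k [c [d [sg1 k0 _ H]]]]];
  exact: (power_solution_system hn hm hIopen sg1 k0 H).
Qed.
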